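(* Let $N\ge2$ and let $H_1,\dots,H_N$ be nonzero complex Hilbert spaces whose dimensions $n_k=\dim H_k$ satisfy $n_1\le n_2\le\cdots\le n_N$ and $n_{N-1}<\infty$ ($n_N$ may be infinite). Let $V$ be the set of all decomposable unit vectors in $H_1\otimes\cdots\otimes H_N$. Then the inner radius of $V$ satisfies $$r(V)\ge\frac1{\sqrt{n_1n_2\cdots n_{N-1}}}.$$
   Context: $V=\{\xi_1\otimes\cdots\otimes\xi_N:\xi_k\in H_k,\ \|\xi_1\|=\cdots=\|\xi_N\|=1\}$. The inner radius $r(V)$ is the largest $r\ge0$ such that $\{\xi\in H_1\otimes\cdots\otimes H_N:\|\xi\|\le r\}$ is contained in the (norm-)closed convex hull of $V$. *)

(* Defs.v *)
From HB Require Import structures.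
From mathcomp Require Import all_boot all_order all_algebra.
From mathcomp Require Import all_classical all_reals all_analysis.
From mathcomp Require Import complex.

Set Implicit Arguments.
Unset Strict Implicit.
Unset Printing Implicit Defensive.

Import Order.TTheory GRing.Theory Num.Theory.
Import numFieldNormedType.Exports.

Local Open Scope classical_set_scope.
Local Open Scope ring_scope.
Local Open Scope complex_scope.

(* Following {dot _ for _}, the inner product is linear on the left. *)
HB.mixin Record isHilbert (R : realType) (V : Type)
    of CompleteNormedModule R[i] V := {
  inner : {dot V for (@Num.conj R[i])};
  normr_sqr_inner : forall x : V, `|x| ^+ 2 = inner x x
}.

#[short(type="hilbertType")]
HB.structure Definition Hilbert (R : realType) :=
  {V of isHilbert R V & CompleteNormedModule R[i] V}.

Section HilbertBasis.
Context {R : realType}.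

Definition lin_span (V : lmodType R[i]) (A : set V) : set V :=
  smallest
    (fun W => W 0 /\ forall a x y, W x -> W y -> W (a *: x + y)) A.

Definition orthonormal_set (V : hilbertType R) (B : set V) : Prop :=
  forall x y, B x -> B y -> inner x y = (x == y)%:R.

Definition hilbert_basis (V : hilbertType R) (B : set V) : Prop :=
  orthonormal_set B /\ closure (lin_span B) = setT.

(* The dimension is the cardinality of an orthonormal basis; infinite
   dimensions are only compared, through [#<=]. *)
Definition hdim_eq (V : hilbertType R) (n : nat) : Prop :=
  exists2 B : set V, hilbert_basis B & (B #= `I_n)%card.

Definition hdim_le (V W : hilbertType R) : Prop :=
  exists (A : set V) (B : set W),
    [/\ hilbert_basis A, hilbert_basis B & (A #<= B)%card].

End HilbertBasis.

Section TensorProduct.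
Context {R : realType} {N : nat}.

(* The Hilbert space tensor product (completion of the algebraic one) is
   determined, up to a unique unitary respecting decomposable vectors, by these
   three properties of the map (x_k)_k |-> x_1 (x) ... (x) x_N. *)
Record is_hilbert_tensor (H : 'I_N -> hilbertType R) (T : hilbertType R)
    (tens : (forall k, H k) -> T) : Prop := {
  tens_multilinear : forall (x : forall k, H k) (k : 'I_N) (a : R[i])
      (u v : H k),
    tens (eqtype.dfwith x (a *: u + v)) =
      a *: tens (eqtype.dfwith x u) + tens (eqtype.dfwith x v);
  tens_inner : forall x y : (forall k, H k),
    inner (tens x) (tens y) = \prod_k inner (x k) (y k);
  tens_dense : closure (lin_span (range tens)) = setT
}.

Definition decomposable_unit (H : 'I_N -> hilbertType R) (T : hilbertType R)
    (tens : (forall k, H k) -> T) : set T :=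
  [set tens x | x in [set x : forall k, H k | forall k, `|x k| = 1]].

End TensorProduct.

Section InnerRadius.
Context {R : realType}.

Definition convex_hull (T : lmodType R[i]) (V : set T) : set T :=
  smallest (@convex_set R[i] T) V.

Definition ball_in_hull (T : hilbertType R) (V : set T) (r : R) : Prop :=
  [set x : T | `|x| <= r%:C] `<=` closure (convex_hull V).

(* The default 0 is used only if there is no largest such r. *)
Definition inner_radius (T : hilbertType R) (V : set T) : R :=
  xget 0 [set r : R | [/\ 0 <= r, ball_in_hull V r
    & forall s, 0 <= s -> ball_in_hull V s -> s <= r]].

End InnerRadius.

(* Main.v *)
(* Expanding each of the factors other than the last in an orthonormal basis,
   every vector [u] of the algebraic tensor product is a sum, over the
   [M = n_1 ... n_(N-1)] multi-indices [f], of vectors [e_f (x) y_f].  These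
   summands are pairwise orthogonal, so [|u|^2 = sum_f |y_f|^2], and
   Cauchy-Schwarz gives [sum_f |y_f| <= sqrt M |u|].  Hence
   [u = sum_f |y_f| (e_f (x) y_f / |y_f|)] lies in the convex hull of the
   decomposable unit vectors, which contains [0], as soon as
   [|u| <= 1 / sqrt M].  The algebraic tensor product being dense, the ball of
   radius [1 / sqrt M] lies in the closed hull. *)
Require Import Defs.
From HB Require Import structures.
From mathcomp Require Import all_boot all_order all_algebra.
From mathcomp Require Import all_classical all_reals all_analysis.
From mathcomp Require Import complex.

Set Implicit Arguments.
Unset Strict Implicit.
Unset Printing Implicit Defensive.

Import Order.TTheory GRing.Theory Num.Theory.
Import numFieldNormedType.Exports.

Local Open Scope classical_set_scope.
Local Open Scope ring_scope.

(** * Inner products and finite orthonormal bases *)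

Section InnerTheory.
Context {R : realType} {V : hilbertType R}.
Implicit Types (x y z v : V) (a : R[i]) (B : set V).

Lemma innerC x y : inner x y = (inner y x)^*%C.
Proof. by rewrite (hermC (inner (s := V))) /= expr0 mul1r. Qed.

Lemma innerZl a x y : inner (a *: x) y = a * inner x y.
Proof. exact: linearZl_LR. Qed.

Lemma innerZr a x y : inner x (a *: y) = a^*%C * inner x y.
Proof. exact: linearZr_LR. Qed.

Lemma innerDl x y z : inner (x + y) z = inner x z + inner y z.
Proof. exact: linearDl. Qed.

Lemma inner_suml (I : finType) (P : pred I) (u : I -> V) x :
  inner (\sum_(i | P i) u i) x = \sum_(i | P i) inner (u i) x.
Proof. exact: linear_sumlz. Qed.

Lemma inner_sumr (I : finType) (P : pred I) (u : I -> V) x :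
  inner x (\sum_(i | P i) u i) = \sum_(i | P i) inner x (u i).
Proof. exact: linear_sumr. Qed.

Lemma innerBr x y z : inner z (x - y) = inner z x - inner z y.
Proof. exact: linearBr. Qed.

Lemma innerBl x y z : inner (x - y) z = inner x z - inner y z.
Proof. exact: linearBl. Qed.

Lemma innerNr x y : inner x (- y) = - inner x y.
Proof. exact: linearNr. Qed.

Lemma inner_normDd x y : inner x y = 0 -> `|x + y| ^+ 2 = `|x| ^+ 2 + `|y| ^+ 2.
Proof. by move=> xy0; rewrite !normr_sqr_inner (hnormDd xy0). Qed.

Lemma inner_eq0 x : inner x x = 0 -> x = 0.
Proof.
move=> x0; apply/eqP; rewrite -normr_eq0 -sqrf_eq0.
by rewrite normr_sqr_inner x0.
Qed.

Lemma closure_normP (A : set V) x :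
  closure A x <-> forall e : R[i], 0 < e -> exists2 y, A y & `|x - y| < e.
Proof.
split=> [clAx e e0|Ax S].
  have [y [Ay]] := clAx _ (nbhsx_ballx x e e0).
  by rewrite -ball_normE /= => xy; exists y.
case/nbhs_ballP => e /= e0 eS; have [y Ay xy] := Ax e e0.
by exists y; split=> //; apply: eS; rewrite -ball_normE.
Qed.

Lemma lin_span_ind (U : lmodType R[i]) (A W : set U) : W 0 ->
  (forall a u w, W u -> W w -> W (a *: u + w)) -> A `<=` W ->
  lin_span A `<=` W.
Proof. by move=> W0 Wlin AW x; apply; split=> //; split. Qed.

(** A nonzero [v] would be approximated by some [w] in the span to within less than [|v|], whereas
    Pythagoras gives [|v - w|^2 = |v|^2 + |w|^2]. *)
Lemma orthogonal_dense_eq0 B v :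
  closure (lin_span B) = setT -> (forall b, B b -> inner b v = 0) -> v = 0.
Proof.
move=> Bdense vB.
have vspan w : lin_span B w -> inner w v = 0.
  move: w; apply: lin_span_ind => // [|a x y x0 y0]; first exact: linear0l.
  by rewrite innerDl innerZl x0 y0 mulr0 addr0.
have /closure_normP clv : closure (lin_span B) v by rewrite Bdense.
apply/eqP; apply: contraT => v0.
have [|w Bw] := clv `|v|; first by rewrite normr_gt0.
have vw : inner v (- w) = 0.
  by rewrite innerNr innerC (vspan _ Bw) conjc0 oppr0.
rewrite -(@ltr_pXn2r _ 2%N) ?nnegrE// inner_normDd// normrN.
by rewrite gtrDl le_gtF ?exprn_ge0.
Qed.

(** The difference between [x] and its finite Fourier sum is orthogonal to the whole basis. Only the
    values of [e] below [n] matter. *)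
Lemma fin_basis_expansion (n : nat) : hdim_eq V n ->
  exists e : nat -> V,
    (forall i j, (i < n)%N -> (j < n)%N -> inner (e i) (e j) = (i == j)%:R) /\
    (forall x, x = \sum_(i < n) inner x (e i) *: e i).
Proof.
case=> B [Bon Bdense]; rewrite card_eq_sym => /card_set_bijP[e [eB einj esurj]].
have eon i j : (i < n)%N -> (j < n)%N -> inner (e i) (e j) = (i == j)%:R.
  move=> ni nj; rewrite Bon; [|exact: eB|exact: eB].
  congr (nat_of_bool _)%:R; apply/eqP/eqP => [|->//]; apply: einj; exact: mem_set.
exists e; split=> // x; apply/eqP; rewrite -subr_eq0; apply/eqP.
apply: (orthogonal_dense_eq0 Bdense) => b /esurj[i ni <-].
rewrite innerBr inner_sumr (bigD1 (Ordinal ni))//= big1 ?addr0.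
  by rewrite innerZr eon// eqxx mulr1 -innerC subrr.
move=> j ji; rewrite innerZr eon//.
by rewrite eq_sym (negbTE (ji : (j : nat) != i)) mulr0.
Qed.

End InnerTheory.

(** * Convex hulls *)

Section ConvexHull.
Context {R : realType} {T : lmodType R[i]}.
Implicit Types (A C : set T).

Lemma convex_setP C : convex_set C <->
  (forall x y (p : R[i]), 0 <= p <= 1 -> C x -> C y -> C (p *: x + (1 - p) *: y)).
Proof.
split=> [cC x y p /andP[p0 p1] Cx Cy|cC x y p].
  have := cC x y (Itv01 p0 p1); rewrite !inE; exact.
rewrite !inE; apply: cC; apply/andP; split; [exact: ge0|exact: le1].
Qed.

Lemma sub_convex_hull A : A `<=` convex_hull A.
Proof. by move=> x Ax C [_]; apply. Qed.

Lemma convex_convex_hull A : convex_set (convex_hull A).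
Proof.
apply/convex_setP => x y p p01 Ax Ay C [cC AC].
by apply: (convex_setP C).1 => //; [apply: Ax|apply: Ay].
Qed.

(** By induction, a partial sum of total weight [s] has the form [s *: c] with [c] in [C]; the
    missing weight [1 - s] is finally put on [0]. *)
Lemma convex_subsum C (I : finType) (P : pred I) (t : I -> R[i]) (v : I -> T) :
  convex_set C -> C 0 -> (forall i, 0 <= t i) -> (forall i, P i -> C (v i)) ->
  \sum_(i | P i) t i <= 1 -> C (\sum_(i | P i) t i *: v i).
Proof.
move=> /convex_setP cC C0 t0 Cv t1.
suff [_ [c Cc ->]] : 0 <= \sum_(i | P i) t i /\ exists2 c, C c &
    \sum_(i | P i) t i *: v i = (\sum_(i | P i) t i) *: c.
  have := cC c 0 (\sum_(i | P i) t i); rewrite scaler0 addr0; apply=> //.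
  by rewrite t1 sumr_ge0.
apply: (big_rec2 (fun u s => 0 <= s /\ exists2 c, C c & u = s *: c)).
  by split=> //; exists 0 => //; rewrite scale0r.
move=> i u s Pi [s0 [c Cc ->]]; split; first by rewrite addr_ge0.
(* The weights cannot be normalised when their sum vanishes; then both are zero and [0] serves as
   the point of [C]. *)
have [ts0|ts0] := eqVneq (t i + s) 0.
  exists 0 => //; rewrite scaler0.
  move/eqP: ts0; rewrite paddr_eq0// => /andP[/eqP -> /eqP ->].
  by rewrite !scale0r addr0.
have ts_gt0 : 0 < t i + s by rewrite lt_def ts0 addr_ge0.
exists (t i / (t i + s) *: v i + (1 - t i / (t i + s)) *: c).
  apply: cC => //; last exact: Cv.
  by rewrite divr_ge0 ?(ltW ts_gt0)//= ler_pdivrMr// mul1r lerDl.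
by rewrite scalerDr !scalerA mulrBr mulr1 mulrCA divff// mulr1 addrAC subrr add0r.
Qed.

End ConvexHull.

(** * Existence of a largest admissible radius *)

Section InnerRadius.
Context {R : realType} {T : hilbertType R}.
Implicit Types (V : set T) (r s : R).
Local Open Scope complex_scope.

Lemma complex_gt0_real (e : R[i]) : 0 < e -> exists2 d : R, 0 < d & e = d%:C.
Proof.
move=> e0; have eE : e = (complex.Re e)%:C by rewrite RRe_real// gtr0_real.
by exists (complex.Re e) => //; rewrite -ltcR -eE.
Qed.

Lemma inner_radius_ge0 V : 0 <= inner_radius V.
Proof. by rewrite /inner_radius; case: xgetP => [r _ []|_]. Qed.

(** The hull stays in the unit ball. If [1 < s], then [s *: v] has norm [s] and cannot be within
    [s - 1] of a point of norm at most [1]. *)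
Lemma ball_in_hull_le1 V (v : T) s : V `<=` [set x | `|x| <= 1] -> `|v| = 1 ->
  0 <= s -> ball_in_hull V s -> s <= 1.
Proof.
move=> V1 v1 s0 Vs; rewrite leNgt; apply/negP => s1.
have sv : `|s%:C *: v| = s%:C by rewrite normrZ v1 mulr1 ger0_norm ?ler0c.
have /closure_normP/(_ (s - 1)%:C) : closure (convex_hull V) (s%:C *: v).
  by apply: Vs => /=; rewrite sv.
case; first by rewrite ltcR subr_gt0.
move=> y Vy svy.
have y1 : `|y| <= 1.
  apply: (Vy [set z | `|z| <= 1]); split=> //.
  apply/convex_setP => a b p /andP[p0 p1] /= a1 b1.
  apply: le_trans (ler_normD _ _) _; rewrite !normrZ !ger0_norm ?subr_ge0//.
  by rewrite -[leRHS](subrKC p) lerD// ler_piMr// subr_ge0.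
have := ler_normD (s%:C *: v - y) y; rewrite subrK sv => /le_lt_trans.
move=> /(_ _ (ltr_leD svy y1)); rewrite rmorphB rmorph1 subrK.
by rewrite ltxx.
Qed.

(** The supremum is attained because the hull is closed: for [s] in [S] within [d / 2] of [sup S],
    scaling [x] by [s / sup S] brings it into an admissible ball and moves it by at most [d / 2]. *)
Lemma ball_in_hull_sup V (S : set R) : has_sup S -> 0 < sup S ->
  (forall s, S s -> 0 <= s /\ ball_in_hull V s) -> ball_in_hull V (sup S).
Proof.
move=> supS S0 SV x /= xS; apply/closure_normP => _ /complex_gt0_real[d d0 ->].
have d2 : 0 < d / 2 by rewrite divr_gt0.
have [s Ss sd] := sup_adherent d2 supS.
have [s0 Vs] := SV _ Ss.
have sS : s <= sup S := sup_upper_bound supS Ss.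
have Vsx : closure (convex_hull V) ((s / sup S)%:C *: x).
  apply: Vs => /=; rewrite normrZ ger0_norm ?ler0c ?divr_ge0 ?(ltW S0)//.
  apply: (le_trans (ler_wpM2l _ xS)); first by rewrite ler0c divr_ge0 ?(ltW S0).
  by rewrite -rmorphM/= divfK// gt_eqF.
move/closure_normP: Vsx => /(_ (d / 2)%:C); rewrite ltcR => /(_ d2)[y Vy xy].
exists y => //.
rewrite (le_lt_trans (ler_distD ((s / sup S)%:C *: x) _ _))//.
rewrite [in ltRHS](splitr d) rmorphD ler_ltD//.
rewrite -[X in X - _]scale1r -scalerBl normrZ -(rmorph1 (real_complex R)) -rmorphB.
have q0 : 0 <= 1 - s / sup S by rewrite subr_ge0 ler_pdivrMr// mul1r.
rewrite ger0_norm ?ler0c//.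
apply: (le_trans (ler_wpM2l _ xS)); first by rewrite ler0c.
rewrite -rmorphM lecR/= mulrBl mul1r divfK ?gt_eqF//.
by rewrite lerBlDl -lerBlDr ltW.
Qed.

(** The bound [b] makes the supremum of the admissible radii finite, hence their maximum, so [xget]
    does not fall back on its default. *)
Lemma le_inner_radius V r b : 0 < r -> ball_in_hull V r ->
  (forall s, 0 <= s -> ball_in_hull V s -> s <= b) -> r <= inner_radius V.
Proof.
move=> r0 Vr Vb; pose S := [set s | 0 <= s /\ ball_in_hull V s].
have Sr : S r by split=> //; exact: ltW.
have supS : has_sup S by split; [exists r | exists b => s [s0 /Vb]; apply].
have rS : r <= sup S := sup_upper_bound supS Sr.
have : exists s, [/\ 0 <= s, ball_in_hull V s
    & forall s', 0 <= s' -> ball_in_hull V s' -> s' <= s].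
  exists (sup S); split.
  - by rewrite (le_trans _ rS)// ltW.
  - by apply: ball_in_hull_sup => //; rewrite (lt_le_trans r0).
  - by move=> s s0 Vs; apply: sup_upper_bound.
by move=> /(xgetPex 0)[_ _]; apply=> //; exact: ltW.
Qed.

End InnerRadius.

(** * Approximation from a dense set inside a ball *)

Section DenseBall.
Context {R : realType} {T : hilbertType R}.
Implicit Types (W C : set T).

(** An approximant in [W] may lie slightly outside the ball. Approximating and then rescaling each
    cost at most [e / 2]. *)
Lemma dense_ball_closure W C (r : R[i]) : closure W = setT -> 0 < r ->
  (forall a u, W u -> W (a *: u)) -> (forall u, W u -> `|u| <= r -> C u) ->
  forall x, `|x| <= r -> closure C x.
Proof.
move=> Wdense r0 WZ WC x xr; apply/closure_normP => e e0.
have e2 : 0 < e / 2 by rewrite divr_gt0.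
have re : 0 < r + e / 2 by rewrite addr_gt0.
have /closure_normP/(_ _ e2)[w Ww xw] : closure W x by rewrite Wdense.
have wre : `|w| <= r + e / 2.
  rewrite -[w](subrK x) addrC (le_trans (ler_normD _ _))// lerD// distrC.
  exact: ltW.
have q0 : 0 <= r / (r + e / 2) by rewrite divr_ge0 ?(ltW r0) ?(ltW re).
(* Shrinking [w] by this factor brings it into the ball of radius [r]. *)
exists (r / (r + e / 2) *: w).
  apply: WC; first exact: WZ.
  rewrite normrZ (ger0_norm q0); apply: le_trans (ler_wpM2l q0 wre) _.
  by rewrite divfK ?gt_eqF.
rewrite (le_lt_trans (ler_distD w _ _))// [ltRHS](splitr e) ltr_leD//.
rewrite -[X in X - _]scale1r -scalerBl normrZ.
have -> : 1 - r / (r + e / 2) = e / 2 / (r + e / 2).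
  apply: (mulIf (lt0r_neq0 re)).
  by rewrite mulrBl mul1r !divfK ?gt_eqF// addrAC subrr add0r.
have q1 : 0 <= e / 2 / (r + e / 2) by rewrite divr_ge0 ?(ltW e2) ?(ltW re).
rewrite (ger0_norm q1); apply: le_trans (ler_wpM2l q1 wre) _.
by rewrite divfK ?gt_eqF.
Qed.

End DenseBall.

(** * Sums over multi-indices *)

Section MultiIndex.
Context {N : nat}.
Variables (l : 'I_N) (n : 'I_N -> nat).

(* The entry at [l] of a multi-index carries no information: it is frozen to [0]. *)
Definition multi_index : {pred {ffun 'I_N -> 'I_(\sum_k n k).+1}} :=
  family (fun k => [pred j : 'I_(\sum_k n k).+1 |
                     if k == l then j == ord0 else (j < n k)%N]).

Lemma multi_index_lt f k : f \in multi_index -> k != l -> (f k < n k)%N.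
Proof. by move/familyP => /(_ k); rewrite inE; case: ifP. Qed.

Lemma multi_index_eq0 f : f \in multi_index -> f l = ord0.
Proof. by move/familyP => /(_ l); rewrite inE eqxx => /eqP. Qed.

(** Distributivity of a product over sums, after padding the factor at [l] with a one-term sum equal
    to [1]. *)
Lemma sum_multi_index (S : comNzSemiRingType) (G : 'I_N -> nat -> S) :
  \sum_(f in multi_index) \prod_(k | k != l) G k (f k) =
  \prod_(k | k != l) \sum_(i < n k) G k i.
Proof.
pose F k (j : 'I_(\sum_k n k).+1) := if k == l then 1 else G k j.
have FE k : \sum_(j : 'I_(\sum_k n k).+1 | if k == l then j == ord0 else (j < n k)%N)
    F k j = if k == l then 1 else \sum_(i < n k) G k i.
  rewrite /F; case: ifP => kl; first by rewrite (big_pred1 ord0).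
  (* All entries share one range, which is large enough because each [n k] is a summand of its
     bound. *)
  rewrite (big_ord_widen (\sum_k n k).+1)//.
  by rewrite leqW// (bigD1 k)//= leq_addr.
transitivity (\sum_(f in multi_index) \prod_k F k (f k)).
  apply: eq_bigr => f _; rewrite [RHS](bigD1 l)//= {1}/F eqxx mul1r.
  by apply: eq_bigr => k kl; rewrite /F (negbTE kl).
rewrite /multi_index.
rewrite -(bigA_distr_big_dep
  (fun k j => if k == l then j == ord0 else (j < n k)%N) F).
rewrite (bigD1 l)//= FE eqxx mul1r.
by apply: eq_bigr => k kl; rewrite FE (negbTE kl).
Qed.

Lemma card_multi_index (S : comNzSemiRingType) :
  \sum_(f in multi_index) (1 : S) = (\prod_(k | k != l) n k)%:R.
Proof.
transitivity (\sum_(f in multi_index) \prod_(k | k != l) (1 : S)).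
  by apply: eq_bigr => f _; rewrite big1.
rewrite (sum_multi_index (fun _ _ => 1)) natr_prod.
by apply: eq_bigr => k _; rewrite sumr_const card_ord.
Qed.

End MultiIndex.

Arguments multi_index {N} l n.

(** * Decomposable vectors *)

Section Tensor.
Context {R : realType} {N : nat} {H : 'I_N -> hilbertType R} {T : hilbertType R}.
Context {tens : (forall k, H k) -> T} (tensT : is_hilbert_tensor tens).
Implicit Types (x : forall k, H k) (k l : 'I_N).

(** Multilinearity is applied to [0 = -1 *: 0 + 0]. *)
Lemma tens_dfwith0 x l : tens (eqtype.dfwith x (0 : H l)) = 0.
Proof.
by rewrite -{1}(addNr 0) -scaleN1r (tens_multilinear tensT) scaleN1r addNr.
Qed.

Lemma tens_dfwithZ x l a (y : H l) :
  tens (eqtype.dfwith x (a *: y)) = a *: tens (eqtype.dfwith x y).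
Proof.
by rewrite -[a *: y]addr0 (tens_multilinear tensT) tens_dfwith0 addr0.
Qed.

Lemma tens_norm x : `|tens x| = \prod_k `|x k|.
Proof.
apply/eqP; rewrite -(@eqrXn2 _ 2)// ?prodr_ge0//.
rewrite normr_sqr_inner (tens_inner tensT) -prodrXl; apply/eqP.
by apply: eq_bigr => k _; rewrite normr_sqr_inner.
Qed.

Lemma decomposable_unit_norm v : decomposable_unit tens v -> `|v| = 1.
Proof. by case=> x x1 <-; rewrite tens_norm big1. Qed.

(** The sign is absorbed by the factor at [l], whose norm it preserves. *)
Lemma decomposable_unitN l v :
  decomposable_unit tens v -> decomposable_unit tens (- v).
Proof.
case=> x x1 <-; exists (eqtype.dfwith x (- x l)).
  move=> k; have [<-|lk] := eqVneq l k; last by rewrite dfwith_out.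
  by rewrite dfwith_in normrN.
rewrite -scaleN1r tens_dfwithZ scaleN1r; congr (- tens _).
apply: functional_extensionality_dep => k.
by have [<-|lk] := eqVneq l k; rewrite ?dfwith_in ?dfwith_out.
Qed.

(** [0] is the midpoint of [v] and [- v]. *)
Lemma convex_hull_decomposable_unit0 l v :
  decomposable_unit tens v -> convex_hull (decomposable_unit tens) 0.
Proof.
move=> Vv.
have := (convex_setP _).1
  (@convex_convex_hull _ _ (decomposable_unit tens)) v (- v) 2^-1.
rewrite (_ : 1 - 2^-1 = 2^-1); last by rewrite {1}(splitr 1) mul1r addrK.
rewrite scalerN subrr; apply.
- by rewrite invr_ge0 ler0n/= invf_le1// ler1n.
- exact: sub_convex_hull.
- by apply: sub_convex_hull; apply: (decomposable_unitN l).
Qed.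

End Tensor.

(** * Expansion along orthonormal bases of the factors other than [l] *)

Section Expansion.
Context {R : realType} {N : nat} {H : 'I_N -> hilbertType R} {T : hilbertType R}.
Context {tens : (forall k, H k) -> T} (tensT : is_hilbert_tensor tens).
Variables (l : 'I_N) (n : 'I_N -> nat) (e : forall k, nat -> H k).
Hypothesis e_orthonormal : forall k, k != l -> forall i j,
  (i < n k)%N -> (j < n k)%N -> inner (e k i) (e k j) = (i == j)%:R.
Hypothesis e_expansion : forall k, k != l -> forall u : H k,
  u = \sum_(i < n k) inner u (e k i) *: e k i.
Local Notation index := {ffun 'I_N -> 'I_(\sum_k n k).+1}.
Implicit Types (f g : index) (x : forall k, H k) (y z : H l).

(** This is $e_f \otimes y$, with [y] in position [l]. *)
Definition slice f y : T := tens (eqtype.dfwith (fun k => e k (f k)) y).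

Lemma inner_tens_slice x f y : inner (tens x) (slice f y) =
  inner (x l) y * \prod_(k | k != l) inner (x k) (e k (f k)).
Proof.
rewrite (tens_inner tensT) (bigD1 l)//= dfwith_in; congr (_ * _).
by apply: eq_bigr => k kl; rewrite dfwith_out// eq_sym.
Qed.

(** Distinct multi-indices differ at some [k], and [k != l] since both are frozen at [l];
    orthonormality then kills the factor at [k]. *)
Lemma inner_slice f g y z : f \in multi_index l n -> g \in multi_index l n ->
  inner (slice f y) (slice g z) = if f == g then inner y z else 0.
Proof.
move=> fI gI; rewrite {1}/slice inner_tens_slice dfwith_in.
have -> : \prod_(k | k != l)
      inner (eqtype.dfwith (fun k => e k (f k)) y k) (e k (g k)) =
    \prod_(k | k != l) (f k == g k)%:R.
  apply: eq_bigr => k kl; rewrite dfwith_out; last by rewrite eq_sym.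
  by rewrite e_orthonormal ?(multi_index_lt fI) ?(multi_index_lt gI).
have [->|fg] := eqVneq f g; first by rewrite big1 ?mulr1// => k _; rewrite eqxx.
have [k fgk] : exists k, f k != g k.
  apply/existsP; rewrite -negb_forall; apply: contra fg => /forallP fg.
  by apply/eqP/ffunP => k; apply/eqP.
have kl : k != l by apply: contraNneq fgk => ->; rewrite !multi_index_eq0.
by rewrite (bigD1 k)//= (negbTE fgk) mul0r mulr0.
Qed.

Lemma norm_sum_slice (y : index -> H l) :
  `|\sum_(f in multi_index l n) slice f (y f)| ^+ 2 =
  \sum_(f in multi_index l n) `|y f| ^+ 2.
Proof.
rewrite normr_sqr_inner inner_suml; apply: eq_bigr => f fI.
rewrite inner_sumr (bigD1 f)//= inner_slice// eqxx big1 ?addr0 ?normr_sqr_inner//.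
by move=> g /andP[gI gf]; rewrite inner_slice// eq_sym (negbTE gf).
Qed.

Lemma parseval k (u : H k) : k != l ->
  `|u| ^+ 2 = \sum_(i < n k) `|inner u (e k i)| ^+ 2.
Proof.
move=> kl; rewrite normr_sqr_inner {2}(e_expansion kl u) inner_sumr.
by apply: eq_bigr => i _; rewrite innerZr mulrC normCK.
Qed.

(* Both sides have the same norm and the same inner product with the left one,
   so no multilinear expansion is needed. *)
Lemma tens_slice_sum x : tens x = \sum_(f in multi_index l n)
  slice f (\prod_(k | k != l) inner (x k) (e k (f k)) *: x l).
Proof.
pose c f := \prod_(k | k != l) inner (x k) (e k (f k)).
set w := RHS.
have xx : inner (tens x) (tens x) = \sum_(f in multi_index l n) `|c f *: x l| ^+ 2.
  rewrite -normr_sqr_inner tens_norm// (bigD1 l)//= exprMn -prodrXl.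
  rewrite (eq_bigr (fun k => \sum_(i < n k) `|inner (x k) (e k i)| ^+ 2)); last first.
    by move=> k kl; rewrite -parseval.
  (* The product of the Parseval sums becomes one sum over multi-indices. *)
  rewrite -(sum_multi_index l n (fun k i => `|inner (x k) (e k i)| ^+ 2)) mulr_sumr.
  by apply: eq_bigr => f _; rewrite normrZ exprMn mulrC /c normr_prod -prodrXl.
have ww : inner w w = inner (tens x) (tens x).
  by rewrite -normr_sqr_inner norm_sum_slice xx.
have xw : inner (tens x) w = inner (tens x) (tens x).
  rewrite xx inner_sumr; apply: eq_bigr => f _.
  rewrite inner_tens_slice innerZr normrZ exprMn normCK normr_sqr_inner.
  by rewrite mulrAC [_^*%C * _]mulrC.
apply/eqP; rewrite -subr_eq0; apply/eqP/inner_eq0.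
have wx : inner w (tens x) = inner (tens x) (tens x) by rewrite innerC xw -innerC.
by rewrite innerBr !innerBl xw wx ww subrr.
Qed.

Lemma slice_lin a f y z : slice f (a *: y + z) = a *: slice f y + slice f z.
Proof. exact: (tens_multilinear tensT). Qed.

Definition slice_sum : set T :=
  [set \sum_(f in multi_index l n) slice f (y f) | y in [set: index -> H l]].

Lemma slice_sum_lin a u v : slice_sum u -> slice_sum v -> slice_sum (a *: u + v).
Proof.
move=> [y _ <-] [z _ <-]; exists (fun f => a *: y f + z f) => //.
by rewrite scaler_sumr -big_split/=; apply: eq_bigr => f _; rewrite slice_lin.
Qed.

Lemma slice_sum0 : slice_sum 0.
Proof. by exists (fun=> 0) => //; rewrite big1// => f _; exact: tens_dfwith0. Qed.

Lemma slice_sumZ a u : slice_sum u -> slice_sum (a *: u).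
Proof. by move=> su; rewrite -[a *: u]addr0; apply: slice_sum_lin slice_sum0. Qed.

(** Sums of slices form a subspace containing every decomposable vector, hence their dense span. *)
Lemma slice_sum_dense : closure slice_sum = setT.
Proof.
apply/seteqP; split=> // v _.
have : closure (lin_span (range tens)) v by rewrite (tens_dense tensT).
apply: closure_subset; apply: lin_span_ind; first exact: slice_sum0.
  by move=> a u w; exact: slice_sum_lin.
by move=> _ [x _ <-]; rewrite tens_slice_sum; exists (fun f =>
  \prod_(k | k != l) inner (x k) (e k (f k)) *: x l).
Qed.

Lemma slice_unit f y : f \in multi_index l n -> `|y| = 1 ->
  decomposable_unit tens (slice f y).
Proof.
move=> fI y1; eexists; last by rewrite /slice; reflexivity.
move=> k; have [<-|lk] := eqVneq l k; first by rewrite dfwith_in.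
rewrite dfwith_out//; apply/eqP; rewrite -(@eqrXn2 _ 2)// expr1n.
have kl : k != l by rewrite eq_sym.
by rewrite normr_sqr_inner e_orthonormal ?(multi_index_lt fI)// eqxx.
Qed.

(** A nonzero [y] is normalised; for [y = 0] the coefficient vanishes and [y0] supplies some unit
    vector. *)
Lemma slice_scale_unit (y0 : H l) f y : f \in multi_index l n -> `|y0| = 1 ->
  exists2 v, decomposable_unit tens v & slice f y = `|y| *: v.
Proof.
move=> fI y01; have [->|yn0] := eqVneq y 0.
  exists (slice f y0); first exact: slice_unit.
  by rewrite normr0 scale0r; exact: tens_dfwith0.
have y0' : `|y| != 0 by rewrite normr_eq0.
exists (slice f (`|y|^-1 *: y)).
  by apply: slice_unit => //; rewrite normrZ normfV normr_id mulVf.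
by rewrite -(tens_dfwithZ tensT) scalerA mulfV// scale1r.
Qed.

Lemma slice_sum_in_hull (y0 : H l) u v : `|y0| = 1 -> decomposable_unit tens v ->
  slice_sum u -> (\prod_(k | k != l) n k)%:R * `|u| ^+ 2 <= 1 ->
  convex_hull (decomposable_unit tens) u.
Proof.
move=> y01 Vv [y _ <-]; rewrite norm_sum_slice.
set M : R[i] := _%:R => ynorm.
have [V Vu sV] : exists2 V : index -> T,
    forall f, f \in multi_index l n -> decomposable_unit tens (V f) &
    forall f, f \in multi_index l n -> slice f (y f) = `|y f| *: V f.
  (* Choice needs a vector for every [f]; outside the multi-indices [v] is the default. *)
  have /choice[V VP] : forall f, exists v, f \in multi_index l n ->
      decomposable_unit tens v /\ slice f (y f) = `|y f| *: v.
    move=> f; have [fI|_] := boolP (f \in multi_index l n); last by exists v.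
    by have [w Vw ->] := slice_scale_unit (y f) fI y01; exists w.
  by exists V => f /VP[].
rewrite (eq_bigr _ sV); apply: convex_subsum.
- exact: convex_convex_hull.
- exact: (convex_hull_decomposable_unit0 tensT l Vv).
- by [].
- by move=> f /Vu; exact: sub_convex_hull.
(* If [M = 0] there are no multi-indices and the sum of the weights is empty. *)
have [M0|M0] := eqVneq M 0.
  have : \sum_(f in multi_index l n) (1 : R[i]) = 0 by rewrite card_multi_index.
  rewrite sumr_const => /eqP; rewrite pnatr_eq0 => /eqP/card0_eq I0.
  rewrite (eq_bigl _ _ I0) big_pred0_eq; exact: ler01.
have M_gt0 : 0 < M by rewrite lt_def M0 ler0n.
(* AM-GM: [2 t <= M t^2 + 1 / M], summed over [M] multi-indices. *)
have amgm (t : R[i]) : 0 <= t -> t *+ 2 <= M * t ^+ 2 + M^-1.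
  move=> t0; rewrite -subr_ge0.
  have -> : M * t ^+ 2 + M^-1 - t *+ 2 = M^-1 * (M * t - 1) ^+ 2.
    rewrite sqrrB1 mulrDr mulr1 mulrBr exprMn expr2 !mulrA mulVf// mul1r.
    by rewrite mulrnAr mulrA mulVf// mul1r -!mulrA addrAC.
  apply: mulr_ge0; first by rewrite invr_ge0 ltW.
  by rewrite real_exprn_even_ge0// realB ?real1// ger0_real// mulr_ge0// ltW.
rewrite -(@ler_pMn2r _ 2)// -sumrMnl.
apply: le_trans (ler_sum _ (fun f _ => amgm _ (normr_ge0 (y f)))) _.
rewrite big_split/= -mulr_sumr.
(* The terms [M^-1] add up to [1], cancelling half of the doubled bound [2]; the hypothesis on the
   norm covers the other half. *)
have -> : \sum_(f in multi_index l n) M^-1 = 1.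
  rewrite -[RHS](mulVf M0) /M -card_multi_index mulr_sumr.
  by apply: eq_bigr => f _; rewrite mulr1.
by rewrite mulr2n lerD2r.
Qed.

End Expansion.

(** * The lower bound on the inner radius *)

Theorem theorem10p1 (R : realType) (N : nat) (hN : (2 <= N)%N)
    (H : 'I_N -> hilbertType R)
    (H_neq0 : forall k, exists x : H k, x != 0)
    (H_mono : forall j k : 'I_N, (j <= k)%N -> hdim_le (H j) (H k))
    (n : 'I_N -> nat)
    (H_dim : forall k : 'I_N, (k.+1 < N)%N -> hdim_eq (H k) (n k))
    (T : hilbertType R) (tens : (forall k, H k) -> T)
    (T_tens : is_hilbert_tensor tens) :
  1 / Num.sqrt (\prod_(k < N | (k.+1 < N)%N) n k)%:R
    <= inner_radius (decomposable_unit tens).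
Proof.
case: N hN H H_neq0 H_mono n H_dim tens T_tens => // N _.
move=> H H_neq0 _ n H_dim tens T_tens; pose l : 'I_N.+1 := ord_max.
have lastE (k : 'I_N.+1) : (k.+1 < N.+1)%N = (k != l).
  by rewrite ltnS ltn_neqAle -ltnS ltn_ord andbT.
rewrite (eq_bigl _ _ lastE); set M := (\prod_(k | k != l) n k)%N.
(* With the convention that [0] has inverse [0], the bound is [0] when [M = 0]. *)
have [->|M0] := eqVneq M 0%N; first by rewrite sqrtr0 invr0 mulr0 inner_radius_ge0.
have unit_vec k : exists u : H k, `|u| = 1.
  have [u u0] := H_neq0 k; exists (`|u|^-1 *: u).
  by rewrite normrZ normfV normr_id mulVf// normr_eq0.
pose u k := sval (cid (unit_vec k)).
have u1 k : `|u k| = 1 by rewrite /u; case: cid.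
have Vu : decomposable_unit tens (tens u) by exists u.
(* Keeping [k != l] under the existential gives a family defined at every [k], with a dummy value at
   [l], where the dimension may be infinite. *)
have basis k : exists e : nat -> H k, k != l ->
    (forall i j, (i < n k)%N -> (j < n k)%N -> inner (e i) (e j) = (i == j)%:R) /\
    (forall x, x = \sum_(i < n k) inner x (e i) *: e i).
  have [kl|_] := boolP (k != l); last by exists (fun=> 0).
  have [|e eP] := @fin_basis_expansion _ (H k) (n k); last by exists e.
  by apply: H_dim; rewrite lastE.
pose e k := sval (cid (basis k)).
have eP k : k != l -> _ := svalP (cid (basis k)).
have r0 : 0 < 1 / Num.sqrt (M%:R : R) by rewrite divr_gt0// sqrtr_gt0 ltr0n lt0n.
(* Decomposable unit vectors have norm [1], so no admissible radius exceeds [1]. *)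
apply: (@le_inner_radius _ _ _ _ 1) => //; last first.
  move=> s s0; apply: (@ball_in_hull_le1 _ _ _ (tens u)) => //.
    by move=> v /(decomposable_unit_norm T_tens) /= ->.
  exact: (decomposable_unit_norm T_tens).
(* By density, only sums of slices in the ball have to be placed in the hull. *)
move=> x /= xr; apply: (dense_ball_closure _ _ _ _ xr).
- exact: (slice_sum_dense T_tens (fun k kl => (eP k kl).1) (fun k kl => (eP k kl).2)).
- by rewrite ltcR.
- by move=> a w; exact: slice_sumZ.
move=> w Ww wr; apply: (slice_sum_in_hull T_tens _ (u1 l) Vu Ww).
  by move=> k kl; exact: (eP k kl).1.
have Mpos : 0 < (M%:R : R[i]) by rewrite ltr0n lt0n.
rewrite -(ler_pdivlMl _ _ Mpos) mulr1 -/M.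
(* The squared radius is exactly [M^-1]. *)
apply: (le_trans (_ : _ <= ((1 / Num.sqrt (M%:R : R))%:C)%C ^+ 2)).
  by rewrite ler_pXn2r ?nnegrE// ?ler0c ltW.
rewrite -rmorphXn/= expr_div_n expr1n sqr_sqrtr ?ler0n// div1r.
by rewrite fmorphV rmorph_nat.
Qed.
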